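(* Subject to nonsingularity of a block, the LU decomposition of an $n\times n$ matrix may be computed by the recursive block method (described in the context) with $T_{LU}(n)$ multiplications, using 2 size-$n/2$ LU decompositions, 2 size-$n/2$ triangular matrix inversions, 1 size-$n/2$ general matrix multiplication, and 2 size-$n/2$ triangular-times-general matrix multiplications. The number of multiplications for LU decomposition by this method is therefore $$T_{LU}(n)=2T_{LU}(n/2)+2T_{\triangle^{-1}}(n/2)+T_\times(n/2)+2T_{\triangle\times}(n/2).$$ The number of multiplications and divisions to invert an $n\times n$ triangular matrix is $T_{\triangle^{-1}}(n)=\tfrac12 n(n+1)$. Multiplying a triangular and a general $n\times n$ matrix blockwise gives $$T_{\triangle\times}(n)=4T_{\triangle\times}(n/2)+2T_\times(n/2).$$ If $T_\times(n)=\alpha n^\omega$, then $$T_{\triangle\times}(n)=\frac{2\alpha}{2^\omega-4}(n^\omega-n^2)+n^2,$$ and the LU decomposition method requires a number of multiplications $$T_{LU}(n)=\alpha(n^\omega-n)\frac{2^\omega}{(2^\omega-2)(2^\omega-4)}+(n^2-n)\left(\frac32-\frac{2\alpha}{2^\omega-4}\right)+\frac12 n\log_2(n)+n\;\in\;O(T_\times(n)).$$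
   Context: $T_\times(n)$, $T_{\triangle\times}(n)$, $T_{\triangle^{-1}}(n)$ and $T_{LU}(n)$ denote, respectively, the costs for size $n\times n$ of general matrix multiplication, of multiplying a triangular by a general matrix, of inverting a triangular matrix, and of LU decomposition (factorization as lower triangular times upper triangular). The method: write the nonsingular matrix as $M=\begin{bmatrix} A&B\\ C&D\end{bmatrix}$ with $n/2\times n/2$ blocks, at least one of which is nonsingular, permuting block rows and columns as necessary so that $A$ is nonsingular (likewise at recursive steps). Recursively compute an LU decomposition $L_1U_1=A$, then $X=CU_1^{-1}$ and $Y=L_1^{-1}B$, then recursively an LU decomposition $L_2U_2=D-XY$; this gives $M=LU$ with $L=\begin{bmatrix} L_1&0\\ X&L_2\end{bmatrix}$, $U=\begin{bmatrix} U_1&Y\\ 0&U_2\end{bmatrix}$. The blockwise product of a general and a triangular matrix is $\begin{bmatrix} A&B\\ C&D\end{bmatrix}\begin{bmatrix} U&0\\ V&W\end{bmatrix}=\begin{bmatrix} AU+BV&BW\\ CU+DV&DW\end{bmatrix}$ with $U,W$ lower triangular (here the letters denote generic blocks).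
   Formalization: n is a power of 2. As a scalar count ½n(n+1) is false (n=2 needs 4): it is proved for lower triangular matrices counting each operation on a whole row once, and is a premise for the T_LU formula and the O bound. The O bound takes α>0, ω>2 (false for ω<2); the formulas exclude zero denominators. *)

(* Defs.v *)
From HB Require Import structures.
From mathcomp Require Import all_boot all_order all_algebra.
From mathcomp Require Import all_classical all_reals all_analysis.

Set Implicit Arguments.
Unset Strict Implicit.
Unset Printing Implicit Defensive.

Import Order.TTheory GRing.Theory Num.Theory.
Import numFieldNormedType.Exports.

Local Open Scope ring_scope.

(* 2 ^ k, by a recursion that makes 'M_(pow2 k.+1) convertible to
   'M_(pow2 k + pow2 k), so that the block operations of matrix.v apply. *)
Fixpoint pow2 (k : nat) : nat :=
  if k is k'.+1 then (pow2 k' + pow2 k')%N else 1%N.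

Lemma pow2E k : pow2 k = (2 ^ k)%N.
Proof. by elim: k => //= k ->; rewrite expnS mul2n addnn. Qed.

Inductive op := GenMul | TriMul | TriInv | LUdec.

(* Call o n ts records one execution of o on n x n operands, ts being the
   executions it launches itself, in order. *)
Inductive calls := Call of op & nat & seq calls.

Definition subcalls (t : calls) : seq (op * nat) :=
  let: Call _ _ ts := t in [seq let: Call o n _ := t' in (o, n) | t' <- ts].

(* General multiplication and triangular inversion are subroutines with given
   costs.  A triangular product or an LU decomposition that launches nothing is
   the 1 x 1 case; it is charged one operation, the value at n = 1 of the closed
   forms of both costs. *)
Fixpoint cost (R : realType) (Tmul Tinv : nat -> R) (t : calls) : R :=
  let: Call o n ts := t in
  match o with
  | GenMul => Tmul n
  | TriInv => Tinv n
  | TriMul | LUdec =>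
    if ts is [::] then 1
    else foldr (fun t' c => cost Tmul Tinv t' + c) 0 ts
  end.

Section Programs.
Variable F : fieldType.

Definition lower_trig n (A : 'M[F]_n) : bool := is_trig_mx A.
Definition upper_trig n (A : 'M[F]_n) : bool := is_trig_mx A^T.

(* Blockwise product of a general matrix G and a triangular matrix T, which is
   lower triangular if low is true and upper triangular otherwise. *)
Fixpoint triMul (low : bool) (k : nat) :
    'M[F]_(pow2 k) -> 'M[F]_(pow2 k) -> 'M[F]_(pow2 k) * calls :=
  match k with
  | 0 => fun G T => (G *m T, Call TriMul (pow2 0) [::])
  | k'.+1 => fun G T =>
    let n := pow2 k' in
    let A := @ulsubmx F n n n n G in let B := @ursubmx F n n n n G in
    let C := @dlsubmx F n n n n G in let D := @drsubmx F n n n n G in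
    let U := @ulsubmx F n n n n T in let W := @drsubmx F n n n n T in
    let V := if low then @dlsubmx F n n n n T else @ursubmx F n n n n T in
    let: (AU, t1) := triMul low A U in
    let: (BW, t2) := triMul low B W in
    let: (CU, t3) := triMul low C U in
    let: (DW, t4) := triMul low D W in
    let gen := Call GenMul n [::] in
    (if low then block_mx (AU + B *m V) BW (CU + D *m V) DW
     else block_mx AU (A *m V + BW) CU (C *m V + DW),
     Call TriMul (pow2 k'.+1) [:: t1; gen; t2; t3; gen; t4])
  end.

(* Product of a lower triangular and a general matrix, by transposition. *)
Definition lowMul (k : nat) (T G : 'M[F]_(pow2 k)) : 'M[F]_(pow2 k) * calls :=
  let: (H, t) := triMul false G^T T^T in (H^T, t).

(* Exchange of the two block rows of M if st.1, of the two block columns if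
   st.2. *)
Definition swap_mx (n : nat) (b : bool) : 'M[F]_(n + n) :=
  if b then block_mx 0 1%:M 1%:M 0 else 1%:M.

Definition block_perm (n : nat) (st : bool * bool) (M : 'M[F]_(n + n)) :
    'M[F]_(n + n) :=
  swap_mx n st.1 *m M *m swap_mx n st.2.

Definition lead_nonsingular (n : nat) (M : 'M[F]_(n + n)) : bool :=
  ulsubmx M \in unitmx.

Definition some_block_nonsingular (n : nat) (M : 'M[F]_(n + n)) : bool :=
  [|| ulsubmx M \in unitmx, ursubmx M \in unitmx,
      dlsubmx M \in unitmx | drsubmx M \in unitmx].

Definition pivoting := forall n, 'M[F]_(n + n) -> bool * bool.

(* "Permuting as necessary": a nonsingular block, if there is one, is brought
   to the upper left corner, and nothing moves if that corner is already
   nonsingular. *)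
Definition pivot_rule (piv : pivoting) : Prop :=
  forall n (M : 'M[F]_(n + n)),
    (some_block_nonsingular M -> lead_nonsingular (block_perm (piv n M) M)) /\
    (lead_nonsingular M -> piv n M = (false, false)).

(* ok holds of every matrix of size at least 2 met by the recursion. *)
Fixpoint every_step (ok : forall n, 'M[F]_(n + n) -> bool) (piv : pivoting)
    (k : nat) : 'M[F]_(pow2 k) -> bool :=
  match k with
  | 0 => fun _ => true
  | k'.+1 => fun M =>
    let n := pow2 k' in
    let M' := @block_perm n (piv n M) M in
    let A := ulsubmx M' in let B := ursubmx M' in
    let C := dlsubmx M' in let D := drsubmx M' in
    [&& ok n M, every_step ok piv A & every_step ok piv (D - C *m invmx A *m B)]
  end.

Record luFact (n : nat) :=
  LUFact { rowP : 'M[F]_n; facL : 'M[F]_n; facU : 'M[F]_n; colP : 'M[F]_n }.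

Definition is_LU (n : nat) (M : 'M[F]_n) (f : luFact n) : Prop :=
  [/\ is_perm_mx (rowP f), is_perm_mx (colP f),
      lower_trig (facL f), upper_trig (facU f) &
      rowP f *m M *m colP f = facL f *m facU f].

(* The recursive block method.  Products by rowP, colP and swap_mx are
   permutations of rows and columns and are not charged: P1, Q1 are applied to
   B, C since it is P1 A Q1 that equals L1 U1, and P2, Q2 to X, Y likewise. *)
Fixpoint blockLU (piv : pivoting) (k : nat) :
    'M[F]_(pow2 k) -> luFact (pow2 k) * calls :=
  match k with
  | 0 => fun M => (LUFact 1%:M 1%:M M 1%:M, Call LUdec (pow2 0) [::])
  | k'.+1 => fun M =>
    let n := pow2 k' in
    let: (s, t) := piv n M in
    let M' := @block_perm n (s, t) M in
    let A := ulsubmx M' in let B := ursubmx M' in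
    let C := dlsubmx M' in let D := drsubmx M' in
    let inv := Call TriInv n [::] in
    let: (LUFact P1 L1 U1 Q1, t1) := blockLU piv A in
    let: (X, t2) := triMul false (C *m Q1) (invmx U1) in
    let: (Y, t3) := lowMul (invmx L1) (P1 *m B) in
    let: (LUFact P2 L2 U2 Q2, t4) := blockLU piv (D - X *m Y) in
    (LUFact (block_mx P1 0 0 P2 *m swap_mx n s)
            (block_mx L1 0 (P2 *m X) L2)
            (block_mx U1 (Y *m Q2) 0 U2)
            (swap_mx n t *m block_mx Q1 0 0 Q2),
     Call LUdec (pow2 k'.+1)
       [:: t1; inv; t2; inv; t3; Call GenMul n [::]; t4])
  end.

(* Inversion of a lower triangular matrix by forward substitution in L X = 1,
   with the number of multiplications and divisions by entries of L.  The
   unknowns are the rows of X: multiplying or dividing a row by an entry of L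
   counts once. *)
Definition subst_row n (L X : 'M[F]_n) (i : 'I_n) : 'rV[F]_n * nat :=
  let: (r, c) := foldl (fun rc j => (rc.1 - L i j *: row j X, rc.2.+1))
                       (row i 1%:M, 0%N) [seq j : 'I_n <- enum 'I_n | (j < i)%N] in
  ((L i i)^-1 *: r, c.+1).

Definition triInv n (L : 'M[F]_n) : 'M[F]_n * nat :=
  foldl (fun Xc i =>
           let: (r, c) := subst_row L Xc.1 i in
           (\matrix_(i', j) (if i' == i then r 0 j else Xc.1 i' j),
            (Xc.2 + c)%N))
        (0, 0%N) (enum 'I_n).

End Programs.

Definition log2 (R : realType) (x : R) : R := ln x / ln 2.

(* Main.v *)
Require Import Defs.
From HB Require Import structures.
From mathcomp Require Import all_boot all_order all_algebra perm.
From mathcomp Require Import all_classical all_reals all_analysis.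
From mathcomp Require Import ring lra.

Set Implicit Arguments.
Unset Strict Implicit.
Unset Printing Implicit Defensive.

Import Order.TTheory GRing.Theory Num.Theory.
Import numFieldNormedType.Exports.

Local Open Scope classical_set_scope.
Local Open Scope ring_scope.

(* With pivots the recursive call yields P1 A Q1 = L1 U1, so that
   X = C Q1 U1^-1 and Y = L1^-1 P1 B satisfy X Y = C A^-1 B: the second
   recursive call is made on the Schur complement of A, which is nonsingular
   together with M and A.  The costs depend on the size only and satisfy linear
   recurrences at powers of 2, of which the closed forms are the solutions.  For
   omega > 2, each of n, n^2 and n log2 n is at most n^omega. *)

(** * Forward substitution for triangular matrices: correctness and operation count *)

Section TriangularInversion.
Variable F : fieldType.

Lemma lower_trig_diag_neq0 n (L : 'M[F]_n) (i : 'I_n) :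
  lower_trig L -> L \in unitmx -> L i i != 0.
Proof.
move=> /det_trig detL; rewrite unitmxE unitfE detL.
by move/prodf_neq0/(_ i isT).
Qed.

(** This is row [i] of [L *m invmx L = 1%:M]: the terms with [j > i] vanish by triangularity, and
    the term [j = i] is isolated on the left. *)
Lemma row_invmx_lower_trig n (L : 'M[F]_n) (i : 'I_n) :
    lower_trig L -> L \in unitmx ->
  L i i *: row i (invmx L) =
    row i 1%:M - \sum_(j < n | (j < i)%N) L i j *: row j (invmx L).
Proof.
move=> /is_trig_mxP trigL unitL.
have /(congr1 (row i)) := mulmxV unitL.
rewrite row_mul mulmx_sum_row => <-.
rewrite (bigID (fun j : 'I_n => (j < i)%N)) /=.
rewrite (eq_bigr (fun j => L i j *: row j (invmx L))) => [|j _]; last first.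
  by rewrite mxE.
rewrite addrC addrK (bigD1 i) ?ltnn //= mxE big1 ?addr0 // => j.
rewrite -leqNgt => /andP[le_ij]; rewrite eq_sym -(inj_eq val_inj) /= => neq_ij.
by rewrite mxE trigL ?scale0r // ltn_neqAle neq_ij.
Qed.

(** Strong induction on the row index. For [i < j] the recurrence for row [i] involves only entries
    of column [j] in earlier rows, which vanish, and an off-diagonal entry of the identity; the
    nonzero [L i i] then cancels. *)
Lemma invmx_lower_trig n (L : 'M[F]_n) :
  lower_trig L -> L \in unitmx -> lower_trig (invmx L).
Proof.
move=> trigL unitL; apply/is_trig_mxP => i j.
have [m] := ubnP (i : nat); elim: m i => // m IHm i le_im lt_ij.
have /rowP/(_ j) := row_invmx_lower_trig i trigL unitL.
have [/ord_inj eq_ij|_] := eqVneq (i : nat) j.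
  by rewrite eq_ij ltnn in lt_ij.
rewrite !mxE summxE big1 => [|l lt_li]; last first.
  have := IHm l (leq_trans lt_li le_im) (ltn_trans lt_li lt_ij).
  by rewrite !mxE => ->; rewrite mulr0.
have /negPf -> : i != j by rewrite -(inj_eq val_inj) ltn_eqF.
move/eqP; rewrite subr0 mulf_eq0 (negPf (lower_trig_diag_neq0 _ trigL unitL)).
by move/eqP.
Qed.

Lemma invmx_upper_trig n (U : 'M[F]_n) :
  upper_trig U -> U \in unitmx -> upper_trig (invmx U).
Proof.
by rewrite /upper_trig trmx_inv -unitmx_tr; apply: invmx_lower_trig.
Qed.

(** The count [i.+1] is one multiplication for each [j < i] and the final division by [L i i]. *)
Lemma subst_rowE n (L X : 'M[F]_n) (i : 'I_n) :
  subst_row L X i =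
    ((L i i)^-1 *:
       (row i 1%:M - \sum_(j < n | (j < i)%N) L i j *: row j X), i.+1).
Proof.
rewrite /subst_row.
have foldE (s : seq 'I_n) r c :
    foldl (fun rc j => (rc.1 - L i j *: row j X, rc.2.+1)) (r, c) s =
    (r - \sum_(j <- s) L i j *: row j X, (c + size s)%N).
  elim: s r c => [|j s IHs] r c /=; first by rewrite big_nil subr0 addn0.
  by rewrite IHs big_cons opprD addrA addSnnS.
rewrite foldE add0n big_filter big_enum_cond /=; congr (_, _.+1).
rewrite -sum1_size big_filter big_enum_cond /=.
rewrite -(big_ord_widen n (fun=> 1%N)) ?sum1_card ?card_ord //.
exact: ltnW (ltn_ord i).
Qed.

(** Loop invariant of [triInv]. Step [i] writes row [i] and reads only rows [j < i], which are
    already those of the inverse. *)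
Lemma triInv_prefix n (L : 'M[F]_n) m :
    lower_trig L -> L \in unitmx -> (m <= n)%N ->
  let: (X, c) := foldl (fun Xc i =>
           let: (r, c) := subst_row L Xc.1 i in
           (\matrix_(i', j) (if i' == i then r 0 j else Xc.1 i' j),
            (Xc.2 + c)%N)) (0, 0%N) (take m (enum 'I_n)) in
  (forall i : 'I_n, (i < m)%N -> row i X = row i (invmx L)) /\
  c = (\sum_(i < m) i.+1)%N.
Proof.
move=> trigL unitL; elim: m => [|m IHm] lt_mn; first by rewrite take0 big_ord0.
pose i := Ordinal lt_mn; rewrite (take_nth i) ?size_enum_ord //.
rewrite (nth_ord_enum i i) foldl_rcons.
case: foldl (IHm (ltnW lt_mn)) => X c [rowX ->] /=.
rewrite subst_rowE big_ord_recr /=; split=> // j; rewrite ltnS => le_jm.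
have [->|neq_ji] := eqVneq j i.
  under eq_bigr => j' lt_j'i do rewrite rowX //.
  rewrite -row_invmx_lower_trig // scalerA mulVf ?lower_trig_diag_neq0 //.
  by rewrite scale1r; apply/rowP => l; rewrite !mxE eqxx.
have lt_jm : (j < m)%N by rewrite ltn_neqAle le_jm andbT.
by rewrite -rowX //; apply/rowP => l; rewrite !mxE (negPf neq_ji).
Qed.

Lemma triInv_correct n (L : 'M[F]_n) : lower_trig L -> L \in unitmx ->
  triInv L = (invmx L, \sum_(i < n) i.+1)%N.
Proof.
move=> trigL unitL; have := triInv_prefix trigL unitL (leqnn n).
rewrite take_oversize ?size_enum_ord // -/(triInv L).
case: triInv => X c [rowX ->]; congr (_, _).
by apply/row_matrixP => i; apply: rowX.
Qed.

End TriangularInversion.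

Lemma sumr_succn (R : numFieldType) n :
  (\sum_(i < n) i.+1)%N%:R = 2^-1 * n%:R * (n%:R + 1) :> R.
Proof.
elim: n => [|n IHn]; first by rewrite big_ord0 mulr0 mul0r.
by rewrite big_ord_recr /= natrD IHn -natr1; field.
Qed.

(** * Correctness of the blockwise triangular product *)

Section TriangularProduct.
Variable F : fieldType.

Lemma mulmx_lower_block n (G T : 'M[F]_(n + n)) : lower_trig T ->
  G *m T = block_mx
    (ulsubmx G *m ulsubmx T + ursubmx G *m dlsubmx T) (ursubmx G *m drsubmx T)
    (dlsubmx G *m ulsubmx T + drsubmx G *m dlsubmx T) (drsubmx G *m drsubmx T).
Proof.
move=> trigT; rewrite -{1}[G]submxK -{1}[T]submxK mulmx_block.
by rewrite (ursubmx_trig (leqnn n) trigT) !mulmx0 !add0r.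
Qed.

Lemma mulmx_upper_block n (G T : 'M[F]_(n + n)) : upper_trig T ->
  G *m T = block_mx
    (ulsubmx G *m ulsubmx T) (ulsubmx G *m ursubmx T + ursubmx G *m drsubmx T)
    (dlsubmx G *m ulsubmx T) (dlsubmx G *m ursubmx T + drsubmx G *m drsubmx T).
Proof.
move=> trigT; rewrite -{1}[G]submxK -{1}[T]submxK mulmx_block.
have -> : dlsubmx T = 0.
  by apply: trmx_inj; rewrite trmx_dlsub (ursubmx_trig (leqnn n) trigT) trmx0.
by rewrite !mulmx0 !addr0.
Qed.

Lemma triMul_correct low k (G T : 'M[F]_(pow2 k)) :
  (if low then lower_trig T else upper_trig T) -> (triMul low G T).1 = G *m T.
Proof.
elim: k G T => [//|k IHk] G T trigT.
have ulT : if low then lower_trig (@ulsubmx _ (pow2 k) _ (pow2 k) _ T)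
           else upper_trig (@ulsubmx _ (pow2 k) _ (pow2 k) _ T).
  by case: low trigT {IHk} => trigT; rewrite /upper_trig ?trmx_ulsub;
     apply: ulsubmx_trig.
have drT : if low then lower_trig (@drsubmx _ (pow2 k) _ (pow2 k) _ T)
           else upper_trig (@drsubmx _ (pow2 k) _ (pow2 k) _ T).
  by case: low trigT {IHk ulT} => trigT; rewrite /upper_trig ?trmx_drsub;
     apply: drsubmx_trig (leqnn _) _.
move=> /=.
case: triMul (IHk (@ulsubmx _ (pow2 k) _ (pow2 k) _ G) _ ulT) => AU t1 /= ->.
case: triMul (IHk (@ursubmx _ (pow2 k) _ (pow2 k) _ G) _ drT) => BW t2 /= ->.
case: triMul (IHk (@dlsubmx _ (pow2 k) _ (pow2 k) _ G) _ ulT) => CU t3 /= ->.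
case: triMul (IHk (@drsubmx _ (pow2 k) _ (pow2 k) _ G) _ drT) => DW t4 /= ->.
case: low trigT {IHk ulT drT} => trigT.
- exact/esym/mulmx_lower_block.
- exact/esym/mulmx_upper_block.
Qed.

Lemma lowMul_correct k (T G : 'M[F]_(pow2 k)) :
  lower_trig T -> (lowMul T G).1 = T *m G.
Proof.
move=> trigT; rewrite /lowMul.
case: triMul (@triMul_correct false k G^T T^T) => H t /= ->.
  by rewrite trmx_mul !trmxK.
by rewrite /upper_trig trmxK.
Qed.

End TriangularProduct.

(** * Correctness of the recursive block LU decomposition *)

Section BlockLU.
Variable F : fieldType.

(** An injective self-map of a finite set is a permutation, so a matrix is recognised as a
    permutation matrix from the column of the 1 in each row. *)
Lemma is_perm_mx_fun n (f : 'I_n -> 'I_n) (A : 'M[F]_n) :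
  injective f -> (forall i j, A i j = (f i == j)%:R) -> is_perm_mx A.
Proof.
move=> inj_f defA; apply/is_perm_mxP; exists (perm inj_f).
by apply/matrixP => i j; rewrite defA !mxE permE.
Qed.

Lemma is_perm_mx_block n1 n2 (P : 'M[F]_n1) (Q : 'M[F]_n2) :
  is_perm_mx P -> is_perm_mx Q -> is_perm_mx (block_mx P 0 0 Q).
Proof.
move=> /is_perm_mxP[s ->] /is_perm_mxP[t ->].
pose f i := match fintype.split i with
            | inl a => lshift n2 (s a) | inr b => rshift n1 (t b) end.
apply: (@is_perm_mx_fun _ f) => [i j|i j]; rewrite /f.
  case: (split_ordP i) => i' ->; case: (split_ordP j) => j' -> /eqP;
  by rewrite eq_shift // => /eqP/perm_inj->.
by case: (split_ordP i) => i' ->; case: (split_ordP j) => j' ->;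
   rewrite eq_shift ?block_mxEul ?block_mxEur ?block_mxEdl ?block_mxEdr !mxE.
Qed.

Lemma swap_mx_perm n b : is_perm_mx (swap_mx F n b).
Proof.
rewrite /swap_mx; case: b; last exact: is_perm_mx1.
(* The exchange of the two halves of the index set. *)
pose f (i : 'I_(n + n)) := match fintype.split i with
            | inl a => rshift n a | inr b => lshift n b end.
apply: (@is_perm_mx_fun _ f) => [i j|i j]; rewrite /f.
  case: (split_ordP i) => i' ->; case: (split_ordP j) => j' -> /eqP;
  by rewrite eq_shift // => /eqP->.
by case: (split_ordP i) => i' ->; case: (split_ordP j) => j' ->;
   rewrite eq_shift ?block_mxEul ?block_mxEur ?block_mxEdl ?block_mxEdr !mxE.
Qed.

Lemma perm_mx_unit n (P : 'M[F]_n) : is_perm_mx P -> P \in unitmx.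
Proof. by move=> /is_perm_mxP[s ->]; apply: unitmx_perm. Qed.

Lemma block_perm_unit n st (M : 'M[F]_(n + n)) :
  M \in unitmx -> block_perm st M \in unitmx.
Proof.
by rewrite /block_perm !unitmx_mul => ->; rewrite !perm_mx_unit ?swap_mx_perm.
Qed.

(** Block elimination writes [M] as a unit lower block triangular matrix times an upper one with
    diagonal blocks [A] and [S], so that [\det S] divides [\det M]. *)
Lemma schur_unit n1 n2 (M : 'M[F]_(n1 + n2)) :
    M \in unitmx -> ulsubmx M \in unitmx ->
  drsubmx M - dlsubmx M *m invmx (ulsubmx M) *m ursubmx M \in unitmx.
Proof.
set A := ulsubmx M; set S := _ - _ => unitM unitA.
have defM : M = block_mx 1%:M 0 (dlsubmx M *m invmx A) 1%:M *m
                block_mx A (ursubmx M) 0 S.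
  rewrite -{1}[M]submxK mulmx_block !mul1mx !mul0mx !addr0 mulmxKV //.
  by rewrite addrC subrK.
move: unitM; rewrite defM unitmx_mul !unitmxE det_ublock unitrM.
by case/and3P.
Qed.

(** Multiplied by [C] on the left and [B] on the right, this turns [X *m Y] into
    [C *m invmx A *m B]. *)
Lemma invmx_perm_LU n (P A Q L U : 'M[F]_n) :
    P *m A *m Q = L *m U -> Q \in unitmx -> L \in unitmx -> U \in unitmx ->
    A \in unitmx ->
  Q *m invmx U *m invmx L *m P = invmx A.
Proof.
move=> defLU unitQ unitL unitU unitA.
have PA : P *m A = L *m U *m invmx Q by rewrite -defLU mulmxK.
rewrite -[LHS](mulmxK unitA) -[_ *m P *m A]mulmxA PA !mulmxA.
by rewrite !mulmxKV // mulmxV // mul1mx.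
Qed.

(** Only the lower right block takes work: there [P2 X Y Q2 + L2 U2] equals [P2 D Q2], since
    [L2 U2 = P2 (D - X Y) Q2]. *)
Lemma mulmx_block_LU n1 n2 (M : 'M[F]_(n1 + n2)) (P1 L1 U1 Q1 : 'M[F]_n1)
    (P2 L2 U2 Q2 : 'M[F]_n2) (X : 'M[F]_(n2, n1)) (Y : 'M[F]_(n1, n2)) :
    P1 *m ulsubmx M *m Q1 = L1 *m U1 ->
    X *m U1 = dlsubmx M *m Q1 -> L1 *m Y = P1 *m ursubmx M ->
    P2 *m (drsubmx M - X *m Y) *m Q2 = L2 *m U2 ->
  block_mx P1 0 0 P2 *m M *m block_mx Q1 0 0 Q2 =
    block_mx L1 0 (P2 *m X) L2 *m block_mx U1 (Y *m Q2) 0 U2.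
Proof.
move=> defA defX defY defS; rewrite -{1}[M]submxK !mulmx_block.
rewrite !(mul0mx, mulmx0, addr0, add0r) defA -!mulmxA defX.
rewrite -defS mulmxBr mulmxBl ![_ *m (_ *m Q2)]mulmxA defY !mulmxA.
by rewrite [X in _ = block_mx _ _ _ X]addrC subrK.
Qed.

(** One induction serves both claims: the pivot rule makes [A] nonsingular, [schur_unit] passes
    nonsingularity on to the second recursive call, and the permutations stay trivial as long as
    every leading block is nonsingular. *)
Lemma blockLU_correct (piv : pivoting F) k (M : 'M[F]_(pow2 k)) :
    pivot_rule piv -> M \in unitmx ->
    every_step (@some_block_nonsingular F) piv M ->
  is_LU M (blockLU piv M).1 /\
  (every_step (@lead_nonsingular F) piv M ->
     Defs.rowP (blockLU piv M).1 = 1%:M /\ Defs.colP (blockLU piv M).1 = 1%:M).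
Proof.
move=> pivP; elim: k M => [|k IHk] M unitM.
  move=> _; split=> //; split=> /=; rewrite ?is_perm_mx1 ?mul1mx ?mulmx1 //.
  - exact: mx11_is_trig.
  - exact: mx11_is_trig.
set n := pow2 k in IHk *.
move=> /= /and3P[/(pivP n M).1 leadM stepA stepS].
have := (pivP n M).2; case def_st: (piv n M) leadM stepA stepS => [s t].
have unitM' := block_perm_unit (s, t) (unitM : (M : 'M[F]_(n + n)) \in unitmx).
move: unitM'; set M' := block_perm _ _ => unitM' unitA stepA stepS trivP.
have [+ trivA] := IHk _ unitA stepA; move: trivA.
case: (blockLU piv _) => -[P1 L1 U1 Q1] t1 /= trivA.
case=> permP1 permQ1 lowL1 upU1 defA.
have [unitP1 unitQ1] := (perm_mx_unit permP1, perm_mx_unit permQ1).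
(* Both factors are invertible because their product [P1 A Q1] is. *)
have /andP[unitL1 unitU1] : (L1 \in unitmx) && (U1 \in unitmx).
  rewrite -unitmx_mul -defA !unitmx_mul unitP1 unitQ1 andbT.
  exact: unitA.
have := @triMul_correct F false k (dlsubmx M' *m Q1) _
  (invmx_upper_trig upU1 unitU1).
case: triMul => X t2 /= defX.
have := @lowMul_correct F k _ (P1 *m ursubmx M')
  (invmx_lower_trig lowL1 unitL1).
case: lowMul => Y t3 /= defY.
(* [every_step] speaks of the Schur complement, the program of [D - X Y]; this identity lets the
   hypothesis on the former apply to the latter. *)
have defXY : X *m Y = dlsubmx M' *m invmx (ulsubmx M') *m ursubmx M'.
  by rewrite defX defY -(invmx_perm_LU defA) // !mulmxA.
rewrite -defXY in stepS *.
have unitS : drsubmx M' - X *m Y \in unitmx by rewrite defXY schur_unit.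
have [+ trivS] := IHk _ unitS stepS; move: trivS.
case: (blockLU piv _) => -[P2 L2 U2 Q2] t4 /= trivS.
case=> permP2 permQ2 lowL2 upU2 defS.
split; last first.
  case/and3P=> /trivP[-> ->] /trivA[-> ->] /trivS[-> ->].
  by rewrite /swap_mx -scalar_mx_block mul1mx.
split=> /=.
- by rewrite is_perm_mxMr ?swap_mx_perm ?is_perm_mx_block.
- by rewrite is_perm_mxMl ?swap_mx_perm ?is_perm_mx_block.
- by rewrite /lower_trig is_trig_block_mx //; apply/and3P; split.
- by rewrite /upper_trig tr_block_mx trmx0 is_trig_block_mx //;
     apply/and3P; split.
rewrite -(mulmx_block_LU defA _ _ defS).
- by rewrite /M' /block_perm /= !mulmxA.
- by rewrite defX mulmxKV.
- by rewrite defY mulKVmx.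
Qed.

End BlockLU.

(** * Cost recurrences, indexed by the exponent [k] of the size [n = 2 ^ k] *)

Section Costs.
Variables (R : realType) (Tmul Tinv : nat -> R).

Fixpoint triMul_cost (k : nat) : R :=
  if k is k'.+1 then 4 * triMul_cost k' + 2 * Tmul (2 ^ k')%N else 1.

Fixpoint blockLU_cost (k : nat) : R :=
  if k is k'.+1 then
    2 * blockLU_cost k' + 2 * Tinv (2 ^ k')%N + Tmul (2 ^ k')%N
      + 2 * triMul_cost k'
  else 1.

Lemma cost_triMul (F : fieldType) low k (G T : 'M[F]_(pow2 k)) :
  cost Tmul Tinv (triMul low G T).2 = triMul_cost k.
Proof.
elim: k G T => [//|k IHk] G T /=; rewrite -pow2E.
case E: triMul => [? ?].
(* Of each recursive result only the cost of its call tree is kept, which by induction does not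
   depend on the matrices. *)
move: {E}(congr1 (fun p => cost Tmul Tinv p.2) E).
rewrite IHk /= => /esym cost1.
case E: triMul => [? ?].
move: {E}(congr1 (fun p => cost Tmul Tinv p.2) E).
rewrite IHk /= => /esym cost2.
case E: triMul => [? ?].
move: {E}(congr1 (fun p => cost Tmul Tinv p.2) E).
rewrite IHk /= => /esym cost3.
case E: triMul => [? ?].
move: {E}(congr1 (fun p => cost Tmul Tinv p.2) E).
rewrite IHk /= => /esym cost4.
rewrite /= cost1 cost2 cost3 cost4.
by ring.
Qed.

Lemma cost_lowMul (F : fieldType) k (T G : 'M[F]_(pow2 k)) :
  cost Tmul Tinv (lowMul T G).2 = triMul_cost k.
Proof.
by rewrite /lowMul -(@cost_triMul F false k G^T T^T); case: triMul.
Qed.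

Lemma cost_blockLU (F : fieldType) (piv : pivoting F) k (M : 'M[F]_(pow2 k)) :
  cost Tmul Tinv (blockLU piv M).2 = blockLU_cost k.
Proof.
elim: k M => [//|k IHk] M /=; rewrite -pow2E.
case: (piv _ _) => s t.
case E: blockLU => [[P1 L1 U1 Q1] ?].
move: {E}(congr1 (fun p => cost Tmul Tinv p.2) E).
rewrite IHk /= => /esym cost1.
case E: triMul => [X ?].
move: {E}(congr1 (fun p => cost Tmul Tinv p.2) E).
rewrite cost_triMul /= => /esym cost2.
case E: lowMul => [Y ?].
move: {E}(congr1 (fun p => cost Tmul Tinv p.2) E).
rewrite cost_lowMul /= => /esym cost3.
case E: blockLU => [[P2 L2 U2 Q2] ?].
move: {E}(congr1 (fun p => cost Tmul Tinv p.2) E).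
rewrite IHk /= => /esym cost4.
rewrite /= cost1 cost2 cost3 cost4.
by ring.
Qed.

(** * Closed forms and growth when general multiplication costs [alpha * n ^ omega] *)

Variables alpha omega : R.
Hypothesis TmulE : forall k, Tmul (2 ^ k)%N = alpha * (2 ^ k)%:R `^ omega.

(** With [n ^ omega] written as the [k]-th power of a fixed number, the induction steps of the
    closed forms become identities for [field]. *)
Lemma powR_exp2 k : (2 ^ k)%:R `^ omega = (2 `^ omega) ^+ k :> R.
Proof.
by rewrite natrX -powR_mulrn // -powRrM mulrC powRrM powR_mulrn ?powR_ge0.
Qed.

(** For [m = 1] and [m = 2] this keeps the denominators of the closed forms nonzero. *)
Lemma powR2_neq (m : nat) : omega != m%:R -> 2 `^ omega != 2 ^+ m :> R.
Proof.
apply: contra_neq => eq_pow; apply/eqP; rewrite -subr_eq0.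
have /eqP : 2 `^ (omega - m%:R) = 1 :> R.
  by rewrite powRB ?pnatr_eq0 ?implybT // eq_pow powR_mulrn // divff.
by rewrite powR_eq1 pnatr_eq1 ltrn0.
Qed.

Lemma log2_exp2 k : log2 (2 ^ k)%:R = k%:R :> R.
Proof.
rewrite /log2 natrX lnXn // -[ln 2 *+ k]mulr_natl mulfK //.
by rewrite gt_eqF // ln_gt0 // ltr1n.
Qed.

(** Doubling [n] multiplies [n ^ 2] by 4, as the homogeneous recurrence does; the coefficient [c] of
    [n ^ omega] solves [c * (2 ^ omega - 4) = 2 * alpha]. *)
Lemma triMul_cost_closed k : omega != 2 -> let n : R := (2 ^ k)%:R in
  triMul_cost k =
    2 * alpha / (2 `^ omega - 4) * (n `^ omega - n ^+ 2) + n ^+ 2.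
Proof.
move=> /(@powR2_neq 2); rewrite -subr_eq0 => neq4 /=.
have {}neq4 : 2 `^ omega - 4 != 0 by rewrite (_ : 4 = 2 ^+ 2) //; ring.
elim: k => [|k IHk] /=; first by rewrite powR1 expr1n subrr mulr0 add0r.
rewrite IHk TmulE !powR_exp2 [_ ^+ k.+1]exprS expnS natrM.
by field.
Qed.

Hypothesis TinvE : forall k,
  let n : R := (2 ^ k)%:R in Tinv (2 ^ k)%N = 2^-1 * n * (n + 1).

(** The logarithm is a resonance: the two inversions contribute a linear term [n / 2], and [n]
    already solves the homogeneous recurrence [T(n) = 2 T(n / 2)]. *)
Lemma blockLU_cost_closed k : omega != 1 -> omega != 2 ->
  let n : R := (2 ^ k)%:R in
  blockLU_cost k =
    alpha * (n `^ omega - n)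
      * (2 `^ omega / ((2 `^ omega - 2) * (2 `^ omega - 4)))
    + (n ^+ 2 - n) * (3 / 2 - 2 * alpha / (2 `^ omega - 4))
    + 2^-1 * n * log2 n + n.
Proof.
move=> /(@powR2_neq 1); rewrite -subr_eq0 expr1 => neq2 omega_neq2 /=.
have neq4 : 2 `^ omega - 4 != 0.
  by have := powR2_neq omega_neq2; rewrite -subr_eq0 (_ : 4 = 2 ^+ 2) //; ring.
elim: k => [|k IHk] /=.
  by rewrite powR1 expr1n /log2 ln1 !(subrr, mul0r, mulr0, add0r).
rewrite IHk (triMul_cost_closed k omega_neq2) TinvE TmulE !log2_exp2 !powR_exp2.
rewrite [_ ^+ k.+1]exprS expnS natrM -[k.+1%:R]natr1.
by field; apply/andP.
Qed.

Lemma blockLU_cost_bigO : 0 < alpha -> 2 < omega ->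
  (blockLU_cost : nat -> R) =O_\oo (fun k : nat => Tmul (2 ^ k)%N).
Proof.
move=> alpha_gt0 omega_gt2; apply/eqO_exP.
have neq1 : omega != 1 by rewrite gt_eqF // (lt_trans _ omega_gt2) // ltr1n.
have neq2 : omega != 2 by rewrite gt_eqF.
pose K := 2 `^ omega / ((2 `^ omega - 2) * (2 `^ omega - 4)).
pose b := 3 / 2 - 2 * alpha / (2 `^ omega - 4).
(* The three summands bound the coefficients of [N - n], of [n ^ 2 - n] and of the remainder
   [n * k / 2 + n]; the division by [alpha] compensates the factor in [Tmul]. *)
exists ((`|alpha * K| + `|b| + 3 / 2) / alpha).
  by rewrite divr_gt0 // ltr_wpDl ?addr_ge0.
(* The bound holds for every [k], from [n <= n ^ 2 <= N] and [n * k <= n ^ 2]. *)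
apply: nearW => k; rewrite TmulE (blockLU_cost_closed k neq1 neq2) log2_exp2.
rewrite -/K -/b; set n : R := (2 ^ k)%:R; set N := n `^ omega.
have n_ge1 : 1 <= n by rewrite ler1n expn_gt0.
have le_kn : k%:R <= n by rewrite ler_nat ltnW // ltn_expl.
have le_n2N : n ^+ 2 <= N.
  by rewrite -powR_mulrn ?(le_trans _ n_ge1) // ler_powR // ltW.
have le_nn2 : n <= n ^+ 2 by rewrite ler_eXnr.
have le_nk : n * k%:R <= n ^+ 2.
  by rewrite expr2 ler_wpM2l // (le_trans _ n_ge1).
have nk_ge0 : 0 <= n * k%:R by rewrite mulr_ge0 // (le_trans _ n_ge1).
have N_ge0 : 0 <= N by apply: powR_ge0.
rewrite (ger0_norm (mulr_ge0 (ltW alpha_gt0) N_ge0)) [leRHS]mulrA.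
rewrite mulfVK ?gt_eqF //.
have -> : alpha * (N - n) * K + (n ^+ 2 - n) * b + 2^-1 * n * k%:R + n =
  alpha * K * (N - n) + b * (n ^+ 2 - n) + (2^-1 * (n * k%:R) + n) by ring.
rewrite 2!(mulrDl _ _ N); apply: le_trans (ler_normD _ _) _; apply: lerD.
  apply: le_trans (ler_normD _ _) _; apply: lerD; rewrite normrM.
    by rewrite ler_wpM2l // ger0_norm; lra.
  by rewrite ler_wpM2l // ger0_norm; lra.
by rewrite ger0_norm; lra.
Qed.

End Costs.

(** * The subroutine calls launched by one step of the decomposition *)

Definition call_head (t : calls) : op * nat := let: Call o n _ := t in (o, n).

Lemma call_head_triMul (F : fieldType) low k (G T : 'M[F]_(pow2 k)) :
  call_head (triMul low G T).2 = (TriMul, (2 ^ k)%N).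
Proof.
by rewrite -pow2E; case: k G T => [//|k] G T /=; do 4!case: triMul => ? ?.
Qed.

Lemma call_head_lowMul (F : fieldType) k (T G : 'M[F]_(pow2 k)) :
  call_head (lowMul T G).2 = (TriMul, (2 ^ k)%N).
Proof.
by rewrite /lowMul -(@call_head_triMul F false k G^T T^T); case: triMul.
Qed.

Lemma call_head_blockLU (F : fieldType) (piv : pivoting F) k
    (M : 'M[F]_(pow2 k)) : call_head (blockLU piv M).2 = (LUdec, (2 ^ k)%N).
Proof.
rewrite -pow2E; case: k M => [//|k] M /=; case: (piv _ _) => s t.
case: blockLU => -[? ? ? ?] ?; case: triMul => ? ?; case: lowMul => ? ?.
by case: blockLU => -[? ? ? ?] ?.
Qed.

Lemma subcalls_blockLU (F : fieldType) (piv : pivoting F) (k : nat)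
    (M : 'M[F]_(pow2 k.+1)) : let n2 := (2 ^ k)%N in
  subcalls (blockLU piv M).2 =
    [:: (LUdec, n2); (TriInv, n2); (TriMul, n2); (TriInv, n2);
        (TriMul, n2); (GenMul, n2); (LUdec, n2)].
Proof.
rewrite /=; case: (piv _ _) => s t.
case E: blockLU => [[P1 L1 U1 Q1] ?].
move: {E}(congr1 (fun p => call_head p.2) E).
rewrite call_head_blockLU => /esym head1.
case E: triMul => [X ?].
move: {E}(congr1 (fun p => call_head p.2) E).
rewrite call_head_triMul => /esym head2.
case E: lowMul => [Y ?].
move: {E}(congr1 (fun p => call_head p.2) E).
rewrite call_head_lowMul => /esym head3.
case E: blockLU => [[P2 L2 U2 Q2] ?].
move: {E}(congr1 (fun p => call_head p.2) E).
rewrite call_head_blockLU => /esym head4.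
(* The anonymous projection inside [subcalls] is folded back into [call_head], so that the recorded
   heads can be rewritten. *)
by rewrite /= -!/(call_head _) head1 head2 head3 head4 pow2E.
Qed.

Theorem mainTheorem2 (F : fieldType) (R : realType) (Tmul Tinv : nat -> R) :
  exists Ttri TLU : nat -> R,
  (forall (low : bool) (k : nat) (G T : 'M[F]_(pow2 k)),
     (if low then lower_trig T else upper_trig T) ->
     (triMul low G T).1 = G *m T /\
     cost Tmul Tinv (triMul low G T).2 = Ttri (2 ^ k)%N) /\
  (forall piv : pivoting F, pivot_rule piv ->
   forall (k : nat) (M : 'M[F]_(pow2 k)), M \in unitmx ->
     every_step (@some_block_nonsingular F) piv M ->
     [/\ is_LU M (blockLU piv M).1,
         cost Tmul Tinv (blockLU piv M).2 = TLU (2 ^ k)%N &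
         every_step (@lead_nonsingular F) piv M ->
           M = facL (blockLU piv M).1 *m facU (blockLU piv M).1]) /\
  (forall (piv : pivoting F) (k : nat) (M : 'M[F]_(pow2 k.+1)),
     let n2 := (2 ^ k)%N in
     subcalls (blockLU piv M).2 =
       [:: (LUdec, n2); (TriInv, n2); (TriMul, n2); (TriInv, n2);
           (TriMul, n2); (GenMul, n2); (LUdec, n2)]) /\
  (forall k : nat,
     TLU (2 ^ k.+1)%N =
       2 * TLU (2 ^ k)%N + 2 * Tinv (2 ^ k)%N + Tmul (2 ^ k)%N
       + 2 * Ttri (2 ^ k)%N) /\
  (forall (n : nat) (L : 'M[F]_n), lower_trig L -> L \in unitmx ->
     (triInv L).1 = invmx L /\
     (triInv L).2%:R = 2^-1 * n%:R * (n%:R + 1) :> R) /\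
  (forall k : nat,
     Ttri (2 ^ k.+1)%N = 4 * Ttri (2 ^ k)%N + 2 * Tmul (2 ^ k)%N) /\
  (forall alpha omega : R,
     (forall k : nat, Tmul (2 ^ k)%N = alpha * (2 ^ k)%:R `^ omega) ->
     (omega != 2 ->
      forall k : nat, let n : R := (2 ^ k)%:R in
        Ttri (2 ^ k)%N =
          2 * alpha / (2 `^ omega - 4) * (n `^ omega - n ^+ 2) + n ^+ 2) /\
     ((forall k : nat, let n : R := (2 ^ k)%:R in
         Tinv (2 ^ k)%N = 2^-1 * n * (n + 1)) ->
      (omega != 1 -> omega != 2 ->
       forall k : nat, let n : R := (2 ^ k)%:R in
         TLU (2 ^ k)%N =
           alpha * (n `^ omega - n)
             * (2 `^ omega / ((2 `^ omega - 2) * (2 `^ omega - 4)))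
           + (n ^+ 2 - n) * (3 / 2 - 2 * alpha / (2 `^ omega - 4))
           + 2^-1 * n * log2 n + n) /\
      (0 < alpha -> 2 < omega ->
       (fun k : nat => TLU (2 ^ k)%N) =O_\oo (fun k : nat => Tmul (2 ^ k)%N)))).
Proof.
(* The recurrences are indexed by the exponent, the stated costs by the size; [trunc_log 2] recovers
   [k] from [2 ^ k]. *)
exists (fun n => triMul_cost Tmul (trunc_log 2 n)).
exists (fun n => blockLU_cost Tmul Tinv (trunc_log 2 n)).
have log2K k : trunc_log 2 (2 ^ k) = k by rewrite trunc_expnK.
split=> [low k G T trigT|].
  by rewrite log2K triMul_correct // cost_triMul.
split=> [piv pivP k M unitM stepM|].
  have [luM trivM] := blockLU_correct pivP unitM stepM.
  split=> //; first by rewrite log2K cost_blockLU.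
  (* With both permutations trivial, the factorization [P M Q = L U] is [M = L U]. *)
  move=> /trivM[P1 Q1]; case: luM => _ _ _ _ <-.
  by rewrite P1 Q1 mul1mx mulmx1.
split; first exact: subcalls_blockLU.
split=> [k|]; first by rewrite !log2K.
split=> [n L trigL unitL|].
  by rewrite triInv_correct //= sumr_succn.
split=> [k|]; first by rewrite !log2K.
move=> alpha omega TmulE; split=> [omega_neq2 k|TinvE].
  by rewrite log2K; apply: triMul_cost_closed.
split=> [omega_neq1 omega_neq2 k|alpha_gt0 omega_gt2].
  by rewrite log2K; apply: blockLU_cost_closed.
under eq_fun do rewrite log2K.
exact: blockLU_cost_bigO.
Qed.
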